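(* Let $D\subset\mathbb R^m$ be a convex set, and let $\mathcal T:D\to\mathbb R^{n^{\times d}}_+$ be logconvex. Then the function $D\to\mathbb R_+$, $x\mapsto\rho_{\mathrm{trop}}(\mathcal T(x))$, is logconvex.
   Context: Let $m,n\ge1$, $d\ge3$ be integers, $[n]=\{1,\dots,n\}$. $\mathbb R^{n^{\times d}}_+$ is the set of tensors $\mathcal S=[s_{i_1,\dots,i_d}]$, $i_1,\dots,i_d\in[n]$, with nonnegative real entries. A nonzero nonnegative vector $u\in\mathbb R^n$ is a tropical eigenvector of $\mathcal S$ with tropical eigenvalue $\lambda$ if $\max_{i_2,\dots,i_d\in[n]}s_{i,i_2,\dots,i_d}u_{i_2}\cdots u_{i_d}=\lambda u_i^{d-1}$ for all $i\in[n]$. Tropical eigenvalues exist and are finite in number; $\rho_{\mathrm{trop}}(\mathcal S)$ is the largest one. A function $f:D\to\mathbb R_+=[0,\infty)$ on a convex set $D$ is logconvex if $\log f:D\to[-\infty,\infty)$ is continuous and convex (with $\log0=-\infty$; such an $f$ that vanishes at one point vanishes identically). A tensor-valued function on $D$ is logconvex if each of its entries is logconvex. *)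

(* Defs.v *)
From HB Require Import structures.
From mathcomp Require Import all_boot all_order all_algebra.
From mathcomp Require Import all_classical all_reals all_analysis.
Import Order.TTheory GRing.Theory Num.Theory.
Import numFieldNormedType.Exports.

Set Implicit Arguments.
Unset Strict Implicit.
Unset Printing Implicit Defensive.

Local Open Scope classical_set_scope.
Local Open Scope convex_scope.
Local Open Scope ring_scope.

Definition tensor (R : realType) (n d : nat) := {ffun d.-tuple 'I_n -> R}.

(* The i-th coordinate is the maximum over i_2, ..., i_d of
   s_(i, i_2, ..., i_d) * u_(i_2) * ... * u_(i_d): the tuple j runs over the
   multi-indices whose first component is i, and [behead j] is the list
   i_2, ..., i_d. The default 0 of the big maximum is harmless because the
   entries of S and u are nonnegative. *)
Definition trop_apply (R : realType) (n d : nat) (S : tensor R n d)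
    (u : 'rV[R]_n) (i : 'I_n) : R :=
  \big[Num.max/0]_(j : d.-tuple 'I_n | ohead j == Some i)
    (S j * \prod_(k <- behead j) u ord0 k).

Definition trop_eigenpair (R : realType) (n d : nat) (S : tensor R n d)
    (lambda : R) (u : 'rV[R]_n) : Prop :=
  [/\ u != 0,
      forall i, 0 <= u ord0 i &
      forall i, trop_apply S u i = lambda * u ord0 i ^+ d.-1].

Definition trop_eigenvalue (R : realType) (n d : nat) (S : tensor R n d)
    (lambda : R) : Prop :=
  exists u : 'rV[R]_n, trop_eigenpair S lambda u.

(* The set of tropical eigenvalues of a nonnegative tensor is finite and
   nonempty, so that its supremum is its largest element. *)
Definition rho_trop (R : realType) (n d : nat) (S : tensor R n d) : R :=
  sup [set lambda | trop_eigenvalue S lambda].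

Lemma rho_tropE (R : realType) (n d : nat) (S : tensor R n d) (lambda : R) :
  trop_eigenvalue S lambda ->
  (forall mu, trop_eigenvalue S mu -> mu <= lambda) ->
  rho_trop S = lambda.
Proof.
move=> Sl lmax; apply/eqP; rewrite eq_le; apply/andP; split.
  by apply: ge_sup => //; exists lambda.
by apply: ub_le_sup => //; exists lambda.
Qed.

(* [lne] is the extended logarithm, with value -oo at 0. Only the values of f
   on D matter, and continuity refers to the subspace topology of D and the
   order topology of \bar R. In the convexity inequality +oo never occurs and
   0 * -oo = 0, which is consistent at the endpoints t = 0, 1. *)
Definition logconvex (R : realType) (m : nat) (D : set 'rV[R]_m)
    (f : 'rV[R]_m -> R) : Prop :=
  [/\ forall x, D x -> 0 <= f x,
      {within D, continuous (fun x => lne (f x)%:E)} &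
      forall (x y : convex_lmodType 'rV[R]_m) (t : {i01 R}), D x -> D y ->
        (lne (f (x <| t |> y))%:E <=
         t%:num%:E * lne (f x)%:E + (1 - t%:num)%:E * lne (f y)%:E)%E].

Definition logconvex_tensor (R : realType) (m n d : nat) (D : set 'rV[R]_m)
    (T : 'rV[R]_m -> tensor R n d) : Prop :=
  forall j : d.-tuple 'I_n, logconvex D (fun x => T x j).

(* Main.v *)
(** Call u > 0 a supersolution of S at level mu if S u^(d-1) <= mu u^(d-1)
    entrywise. A supersolution at level mu bounds every eigenvalue by mu, and
    rho_trop S is the infimum of the levels that admit one. For the latter,
    replace S by S + eps and the exponent d-1 on the right-hand side by
    d-1+delta: this modified problem has a positive solution y (Tarski on a
    box), which after normalisation to max y = 1 is a supersolution of S at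
    some level l and converges, along an ultrafilter, to an eigenvector of S
    for the limit of the l.
    Log-convexity follows because weighted geometric means of supersolutions
    are supersolutions. For continuity, an entry of T that vanishes somewhere
    vanishes identically, so near x0 all entries of T x and T x0 agree up to a
    factor c > 1, hence so do the values of rho_trop. *)
Require Import Defs.
From HB Require Import structures.
From mathcomp Require Import all_boot all_order all_algebra.
From mathcomp Require Import all_classical all_reals all_analysis.
Import Order.TTheory GRing.Theory Num.Theory.
Import numFieldNormedType.Exports.

Local Open Scope classical_set_scope.
Local Open Scope ring_scope.

(** * Monotonicity and homogeneity of [trop_apply]; supersolutions bound eigenvalues *)

Section TropApply.
Context {R : realType} {n d : nat}.
Implicit Types (S : tensor R n d) (u v : 'rV[R]_n) (i : 'I_n).

Lemma trop_apply_ge0 S u i : 0 <= trop_apply S u i.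
Proof. exact: bigmax_ge_id. Qed.

Lemma le_trop_apply_term S u i (j : d.-tuple 'I_n) : ohead j == Some i ->
  S j * \prod_(k <- behead j) u ord0 k <= trop_apply S u i.
Proof.
exact: (le_bigmax_cond 0 (fun j : d.-tuple 'I_n =>
  S j * \prod_(k <- behead j) u ord0 k)).
Qed.

Lemma le_trop_apply S S' u v i :
  (forall j, 0 <= S j) -> (forall j, S j <= S' j) ->
  (forall k, 0 <= u ord0 k) -> (forall k, u ord0 k <= v ord0 k) ->
  trop_apply S u i <= trop_apply S' v i.
Proof.
move=> S0 SS' u0 uv; apply: le_bigmax2 => j _; apply: ler_pM => //.
  exact: prodr_ge0.
by apply: ler_prod => k _; rewrite u0 uv.
Qed.

Lemma prod_behead_const (c : R) (j : d.-tuple 'I_n) :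
  \prod_(k <- behead j) c = c ^+ d.-1.
Proof. by rewrite big_const_seq count_predT size_behead size_tuple iter_mulr_1. Qed.

Lemma trop_applyZ S u i (c : R) : 0 <= c ->
  trop_apply S (c *: u) i = c ^+ d.-1 * trop_apply S u i.
Proof.
move=> c0; rewrite /trop_apply.
(* Multiplication by [c ^+ d.-1 >= 0] commutes with maxima and fixes the default value 0. *)
rewrite (big_morph _ (fun x y => maxr_pMr x y (exprn_ge0 d.-1 c0)) (mulr0 _)).
apply: eq_bigr => j _.
under eq_bigr do rewrite mxE.
by rewrite big_split prod_behead_const mulrCA.
Qed.

Definition supersolution S (mu : R) u :=
  (forall i, 0 < u ord0 i) /\
  (forall i, trop_apply S u i <= mu * u ord0 i ^+ d.-1).

(** Scale [u] by the largest ratio [c] of the coordinates of [v] to those of [u]: then v <= c u,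
    with equality at some [i] where v_i > 0. Monotonicity and homogeneity give lambda v_i^(d-1) <=
    c^(d-1) mu u_i^(d-1) = mu v_i^(d-1). *)
Lemma eigenvalue_le_supersolution S (lambda mu : R) u :
  (forall j, 0 <= S j) ->
  trop_eigenvalue S lambda -> supersolution S mu u -> lambda <= mu.
Proof.
move=> S0 [v [v0 vge0 Sv]] [u0 Su].
have /rV0Pn[i0 vi0] := v0.
pose c := \big[Num.max/0]_i (v ord0 i / u ord0 i).
have [i _ ci] : {i | i \in 'I_n & c = v ord0 i / u ord0 i}.
  by apply: (eq_bigmax i0) => // i _; rewrite divr_ge0// ltW.
have c0 : 0 < c.
  apply: lt_le_trans (le_bigmax 0 (fun i => v ord0 i / u ord0 i) i0).
  by rewrite divr_gt0// lt_neqAle eq_sym vi0 vge0.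
have vi : v ord0 i = c * u ord0 i by rewrite ci divfK// gt_eqF.
have vp : 0 < v ord0 i ^+ d.-1 by rewrite vi exprn_gt0// mulr_gt0.
rewrite -(ler_pM2r vp) -Sv vi exprMn mulrCA.
apply: le_trans (_ : trop_apply S (c *: u) i <= _).
  apply: le_trop_apply => // k; rewrite mxE -ler_pdivrMr//.
  exact: (le_bigmax 0 (fun i => v ord0 i / u ord0 i)).
by rewrite trop_applyZ ?(ltW c0)// ler_pM2l ?exprn_gt0.
Qed.

End TropApply.

(** * Positive solutions of the perturbed eigenproblem *)

(** Knaster-Tarski: the coordinatewise supremum [y] of the points v of the box with v <= G v still
    satisfies y <= G y. By monotonicity G y lies in the same set, whence G y <= y. *)
Lemma tarski_box (R : realType) (n : nat) (a b : R) (G : 'rV[R]_n -> 'I_n -> R) :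
  a <= b ->
  (forall u v : 'rV[R]_n, (forall i, a <= u ord0 i) -> (forall i, u ord0 i <= v ord0 i) ->
    forall i, G u i <= G v i) ->
  (forall i, a <= G (const_mx a) i) -> (forall i, G (const_mx b) i <= b) ->
  exists y : 'rV[R]_n,
    [/\ forall i, a <= y ord0 i, forall i, y ord0 i <= b &
        forall i, G y i = y ord0 i].
Proof.
move=> ab Gm Ga Gb.
pose A : set 'rV[R]_n := [set v : 'rV[R]_n | [/\ forall i, a <= v ord0 i,
  forall i, v ord0 i <= b & forall i, v ord0 i <= G v i]].
have Aa : A (const_mx a).
  by split=> i; rewrite ?mxE.
pose y : 'rV[R]_n := \row_i sup [set (v : 'rV[R]_n) ord0 i | v in A].
have yub (v : 'rV[R]_n) i : A v -> v ord0 i <= y ord0 i.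
  move=> Av; rewrite mxE; apply: ub_le_sup; last by exists v.
  by exists b => _ [w [_ wb _] <-].
have yle i z : (forall v : 'rV[R]_n, A v -> v ord0 i <= z) -> y ord0 i <= z.
  move=> vz; rewrite mxE; apply: ge_sup.
    by exists ((const_mx a : 'rV[R]_n) ord0 i), (const_mx a).
  by move=> _ [w Aw <-]; exact: vz.
clearbody y.
have ay i : a <= y ord0 i by have := yub _ i Aa; rewrite mxE.
have yb i : y ord0 i <= b by apply: yle => v [].
have yG i : y ord0 i <= G y i.
  apply: yle => v Av; have [av _ /(_ i)/le_trans] := Av; apply.
  by apply: Gm => // k; exact: yub.
exists y; split => // i; apply/eqP; rewrite eq_le yG andbT.
have AG : A (\row_k G y k).
  split=> k; rewrite ?mxE.
  - exact: le_trans (yG k).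
  - by apply: le_trans (Gb k); apply: Gm => // l; rewrite mxE.
  - by apply: Gm => // l; rewrite mxE.
by have := yub _ i AG; rewrite mxE.
Qed.

(** Because the exponent q = d-1+delta exceeds d-1, the monotone map sending u to the q-th root of S
    u^(d-1) preserves a box of positive vectors. A fixed point in that box is then normalised to
    have maximum 1. *)
Lemma regularised_eigenpair (R : realType) (n d : nat) (S : tensor R n d)
    (s M delta : R) : (0 < n)%N -> (0 < d)%N ->
  0 < s -> 0 < delta -> (forall j, s <= S j <= M) ->
  exists (l : R) (y : 'rV[R]_n),
    [/\ 0 <= l <= M, forall i, 0 < y ord0 i <= 1, exists i, y ord0 i = 1 &
        forall i, trop_apply S y i = l * y ord0 i `^ (d.-1%:R + delta)].
Proof.
move=> n0 d0 s0 del0 SM.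
have i0 : 'I_n := Ordinal n0.
have S0 j : 0 <= S j by case/andP: (SM j) => /(lt_le_trans s0)/ltW.
have sM : s <= M.
  by case/andP: (SM (nseq_tuple d i0)); exact: le_trans.
have M0 : 0 < M by exact: lt_le_trans sM.
pose q : R := d.-1%:R + delta.
have q0 : 0 < q by rewrite ltr_wpDl.
have powq (x : R) : 0 <= x -> x `^ q = x ^+ d.-1 * x `^ delta.
  move=> x0; rewrite powRD ?powR_mulrn//.
  by rewrite gt_eqF.
have rootK (x r : R) : 0 <= x -> r != 0 -> (x `^ r^-1) `^ r = x.
  by move=> x0 r0; rewrite -powRrM mulVf// powRr1.
have root'K (x r : R) : 0 <= x -> r != 0 -> (x `^ r) `^ r^-1 = x.
  by move=> x0 r0; rewrite -powRrM divff// powRr1.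
have del_neq0 : delta != 0 by rewrite gt_eqF.
have q_neq0 : q != 0 by rewrite gt_eqF.
have qV0 : 0 <= q^-1 by rewrite invr_ge0 ltW.
(* These endpoints solve s a^(d-1) = a^q and M b^(d-1) = b^q, so the map does not decrease the
   constant vector a and does not increase the constant vector b. *)
pose a := s `^ delta^-1; pose b := M `^ delta^-1.
have a0 : 0 < a by exact: powR_gt0.
have b0 : 0 < b by exact: powR_gt0.
have [y [ay yb Gy]] : exists y : 'rV[R]_n, [/\ forall i, a <= y ord0 i,
    forall i, y ord0 i <= b & forall i, trop_apply S y i `^ q^-1 = y ord0 i].
  apply: (@tarski_box R n a b (fun y i => trop_apply S y i `^ q^-1)).
  - by apply: ge0_ler_powR; rewrite ?nnegrE ?invr_ge0 ?(ltW s0) ?(ltW M0) ?(ltW del0).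
  - move=> u v au uv i; apply: ge0_ler_powR; rewrite ?nnegrE ?trop_apply_ge0//.
    by apply: le_trop_apply => // k; exact: le_trans (ltW a0) _.
  - move=> i; rewrite -[leLHS](root'K a q) ?(ltW a0)//.
    apply: ge0_ler_powR; rewrite ?nnegrE ?trop_apply_ge0 ?powR_ge0//.
    (* The term of the diagonal multi-index (i, ..., i) alone gives the lower bound s a^(d-1). *)
    have h : ohead (nseq_tuple d i) == Some i by case: (d) d0.
    apply: (le_trans _ (le_trop_apply_term S (const_mx a) i _ h)).
    under eq_bigr do rewrite mxE.
    rewrite prod_behead_const powq ?(ltW a0)// rootK ?(ltW s0)// mulrC.
    by rewrite ler_pM2r ?exprn_gt0//; case/andP: (SM (nseq_tuple d i)).
  - move=> i; rewrite -[leRHS](root'K b q) ?(ltW b0)//.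
    apply: ge0_ler_powR; rewrite ?nnegrE ?trop_apply_ge0 ?powR_ge0//.
    apply: bigmax_le; first exact: powR_ge0.
    move=> j _; under eq_bigr do rewrite mxE.
    rewrite prod_behead_const powq ?(ltW b0)// rootK ?(ltW M0)// mulrC.
    by rewrite ler_pM2l ?exprn_gt0//; case/andP: (SM j).
have y0 i : 0 < y ord0 i by exact: lt_le_trans (ay i).
pose c := \big[Num.max/0]_i y ord0 i.
have [i1 _ ci] : {i | i \in 'I_n & c = y ord0 i}.
  by apply: (eq_bigmax i0) => // i _; rewrite ltW.
have c0 : 0 < c by rewrite ci.
have yc i : y ord0 i <= c by exact: (le_bigmax 0 (fun i => y ord0 i)).
(* The two sides are homogeneous of degrees d-1 and d-1+delta, so dividing the fixed point by its
   maximum c turns the factor 1 into c^delta, which is at most b^delta = M. *)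
exists (c `^ delta), (c^-1 *: y); split.
- rewrite powR_ge0/= -(rootK M delta) ?(ltW M0)//.
  by apply: ge0_ler_powR; rewrite ?nnegrE ?(ltW c0) ?(ltW b0) ?(ltW del0)// ci yb.
- by move=> i; rewrite mxE mulr_gt0 ?invr_gt0//= mulrC ler_pdivrMr// mul1r.
- by exists i1; rewrite mxE -ci mulVf// gt_eqF.
- move=> i; rewrite trop_applyZ ?invr_ge0 ?ltW// mxE.
  rewrite powRM ?invr_ge0 ?ltW// -/q -[in RHS](Gy i) rootK ?trop_apply_ge0//.
  rewrite mulrA; congr (_ * _).
  rewrite powq ?invr_ge0 ?ltW// mulrCA -powRM ?invr_ge0 ?ltW//.
  by rewrite divff ?gt_eqF// powR1 mulr1.
Qed.

(** * Passage to the limit along an ultrafilter *)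

(** If a finer proper filter held a set A whose preimage is not in [F], the preimage of the
    complement would be in [F], and the finer filter would contain both A and its complement. *)
Lemma ultra_fmap (T V : Type) (F : set_system T) (f : T -> V) :
  UltraFilter F -> UltraFilter (f @ F).
Proof.
move=> UF; split=> [|G PG sFG]; first exact: fmap_proper_filter.
apply/seteqP; split=> // A GA.
have [//|FnA] := in_ultra_setVsetC (f @^-1` A) UF.
have /sFG GnA : (f @ F) (~` A) by [].
by apply: contrapT => _; apply: (@filter_not_empty V G PG); rewrite -(setICr A); exact: filterI.
Qed.

(** Compactness of [a, b]. One ultrafilter serves all bounded functions at once, so levels and
    coordinates converge together without successive subsequences. *)
Lemma cvg_ultra_bounded (R : realType) (T : Type) (F : set_system T)
    (f : T -> R) (a b : R) :
  UltraFilter F -> (forall x, a <= f x <= b) ->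
  exists2 l : R, a <= l <= b & f @ F --> l.
Proof.
move=> UF fab; have UfF := ultra_fmap _ _ _ f UF.
have := @segment_compact R a b; rewrite compact_ultra => /(_ (f @ F) UfF).
have fF : (f @ F) [set` `[a, b]].
  by apply: (@filterE _ F) => x /=; rewrite in_itv/= fab.
move=> /(_ fF)[l [/=]]; rewrite in_itv/= => lab fl.
by exists l.
Qed.

Lemma cvg_trop_apply (R : realType) (n d : nat) (T : Type) (F : set_system T)
    (Sf : T -> tensor R n d) (uf : T -> 'rV[R]_n) (S : tensor R n d)
    (u : 'rV[R]_n) (i : 'I_n) : Filter F ->
  (forall j, Sf x j @[x --> F] --> S j) ->
  (forall k, uf x ord0 k @[x --> F] --> u ord0 k) ->
  trop_apply (Sf x) (uf x) i @[x --> F] --> trop_apply S u i.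
Proof.
move=> FF cS cu; apply: cvg_big => [|j _].
  move=> x; apply: (@continuous_max R _ (fun x : R * R => x.1) (fun x : R * R => x.2)).
    exact: cvg_fst.
  exact: cvg_snd.
apply: cvgM; first exact: cS.
by apply: cvg_big => [|k _]; [exact: mul_continuous|exact: cu].
Qed.

(** The bound is uniform in [y], as needed when coordinates of the perturbed solutions tend to 0. It
    combines 1 - exp(-x) <= x for x = -delta ln y with y^p <= y and -ln y = ln(1/y) <= 1/y. *)
Lemma powR_perturb (R : realType) (y delta : R) (p : nat) :
  0 < y <= 1 -> (0 < p)%N -> 0 < delta ->
  `|y ^+ p - y `^ (p%:R + delta)| <= delta.
Proof.
case: p => // p /andP[y0 y1] _ d0.
have ly : ln y <= 0 by rewrite ln_le0.
have -> : y `^ (p.+1%:R + delta) = y ^+ p.+1 * expR (delta * ln y).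
  rewrite powRD; last by rewrite (gt_eqF y0) implybT.
  rewrite powR_mulrn ?(ltW y0)//.
  by rewrite /powR (gt_eqF y0).
have yp0 : 0 < y ^+ p.+1 by exact: exprn_gt0.
rewrite ger0_norm; last first.
  by rewrite subr_ge0 ger_pMr// -[leRHS]expR0 ler_expR mulr_ge0_le0// ltW.
have e1 : y ^+ p.+1 - y ^+ p.+1 * expR (delta * ln y) <=
          y ^+ p.+1 * (delta * - ln y).
  rewrite -{1}[y ^+ p.+1]mulr1 -mulrBr ler_pM2l// lerBlDl mulrN -lerBlDr opprK.
  by rewrite expR_ge1Dx.
apply: le_trans e1 _; rewrite mulrCA -[leRHS]mulr1 ler_pM2l//.
apply: le_trans (_ : y * y^-1 <= _); last by rewrite divff ?gt_eqF.
apply: ler_pM; rewrite ?oppr_ge0 ?(ltW yp0)//.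
  by rewrite exprS ger_pMr// exprn_ile1// ltW.
by rewrite -lnV ?posrE// ltW// ln_sublinear ?invr_gt0.
Qed.

(** Since a supersolution level bounds every eigenvalue, the second clause makes [l] both the
    largest eigenvalue and the infimum of the supersolution levels. *)
Lemma exists_eigenvalue_supersolution (R : realType) (n d : nat)
    (S : tensor R n d) : (0 < n)%N -> (1 < d)%N -> (forall j, 0 <= S j) ->
  exists2 l, trop_eigenvalue S l &
    forall mu, l < mu -> exists u, supersolution S mu u.
Proof.
move=> n0 d1 S0; have d0 : (0 < d)%N by exact: ltnW.
have p0 : (0 < d.-1)%N by case: (d) d1 => // -[].
pose e (k : nat) : R := k.+1%:R^-1.
have e0 k : 0 < e k by rewrite invr_gt0.
have e1 k : e k <= 1 by rewrite invf_le1// ler1n.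
(* The same [e k] shifts the entries, bounds them below and perturbs the exponent; [e k <= 1] makes
   [M] an upper bound independent of [k]. *)
pose Sk k : tensor R n d := [ffun j => S j + e k].
pose M := \sum_j S j + 1.
have SM j : S j + 1 <= M.
  by rewrite lerD2r (bigD1 j)//= lerDl sumr_ge0.
have /choice[ly lyP] : forall k, exists ly : R * 'rV[R]_n,
    [/\ 0 <= ly.1 <= M, forall i, 0 < ly.2 ord0 i <= 1,
        exists i, ly.2 ord0 i = 1 &
        forall i, trop_apply (Sk k) ly.2 i
                  = ly.1 * ly.2 ord0 i `^ (d.-1%:R + e k)].
  move=> k; have := @regularised_eigenpair R n d (Sk k) (e k) M (e k) n0 d0.
  case=> // [j|l [y ?]]; last by exists (l, y).
  by rewrite ffunE lerDr S0/= (le_trans _ (SM j))// lerD2l.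
have SyE k i : trop_apply (Sk k) (ly k).2 i
             = (ly k).1 * (ly k).2 ord0 i `^ (d.-1%:R + e k).
  by have [_ _ _ ->] := lyP k.
have [U [UU sU]] := @ultraFilterLemma nat \oo _.
have UF : Filter U by exact: ultra_proper.
have eU : e @ U --> (0 : R).
  by apply: cvg_trans (@cvg_harmonic R); apply: cvg_app.
have [l lM lU] : exists2 l : R, 0 <= l <= M & (ly k).1 @[k --> U] --> l.
  by apply: cvg_ultra_bounded => k; have [] := lyP k.
have /choice[y yP] : forall i, exists z : R, 0 <= z <= 1 /\
    (ly k).2 ord0 i @[k --> U] --> z.
  move=> i; have [k|z ? ?] := @cvg_ultra_bounded R nat U
    (fun k => (ly k).2 ord0 i) 0 1 UU; last by exists z.
  by have [_ /(_ i)/andP[/ltW -> ->]] := lyP k.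
exists l.
  exists (\row_i y i); split.
  (* The limit vector is nonzero: each normalised solution has a coordinate equal to 1, so its
     coordinate sum is at least 1, and this survives in the limit. *)
  - have : 1 <= \sum_i y i.
      have cs : \sum_i (ly k).2 ord0 i @[k --> U] --> \sum_i y i.
        by apply: cvg_big => [|i _]; [exact: add_continuous|case: (yP i)].
      rewrite -(cvg_lim _ cs)//; apply: limr_ge; first by apply/cvg_ex; eexists; exact: cs.
      apply: filterE => k; have [_ yk [i <-] _] := lyP k.
      rewrite (bigD1 i)//= lerDl sumr_ge0// => i' _.
      by have /andP[/ltW] := yk i'.
    apply: contraTneq => /rowP y0.
    rewrite big1 ?ltNge -?real_leNgt ?ler10// => i _.
    by have := y0 i; rewrite !mxE.
  - by move=> i; rewrite mxE; have [/andP[]] := yP i.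
  - move=> i; rewrite mxE.
    have c1 : trop_apply (Sk k) (ly k).2 i @[k --> U] --> trop_apply S (\row_i y i) i.
      apply: cvg_trop_apply => [j|i']; last by rewrite mxE; case: (yP i').
      under eq_fun do rewrite ffunE.
      have := cvgD (cvg_cst (S j) : _ @[k --> U] --> _) eU.
      by rewrite addr0; exact.
    (* The perturbed equation gives a second limit of the same quantity; uniqueness of limits yields
       the eigenvalue equation. *)
    have c2 : trop_apply (Sk k) (ly k).2 i @[k --> U] --> l * y i ^+ d.-1.
      under eq_fun => k do rewrite (SyE k i).
      apply: cvgM => //.
      have c3 : (ly k).2 ord0 i ^+ d.-1 @[k --> U] --> y i ^+ d.-1.
        exact: (cvg_comp (fun k => (ly k).2 ord0 i) (fun x => x ^+ d.-1)
          (proj2 (yP i)) (@exprn_continuous R d.-1 (y i))).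
      suff c4 : (ly k).2 ord0 i ^+ d.-1 - (ly k).2 ord0 i `^ (d.-1%:R + e k) @[k --> U] --> (0 : R).
        have := cvgB c3 c4; rewrite subr0.
        under eq_cvg do rewrite /= subKr.
        exact.
      apply: norm_cvg0; apply: (@squeeze_cvgr _ _ _ _ (fun=> 0) e) => //; last exact: cvg_cst.
      apply: filterE => k; rewrite normr_ge0/= powR_perturb//.
      by have [_ /(_ i)] := lyP k.
    exact: (cvg_unique (@norm_hausdorff R R^o) c1 c2).
move=> mu lmu.
(* Some perturbed level is already below [mu]. Its positive vector serves [S] itself, because the
   entries of [S] are below those of [Sk k] and coordinates at most 1 satisfy y^(d-1+e k) <=
   y^(d-1). *)
have : \forall k \near U, (ly k).1 < mu by exact: (cvgr_lt l).
move=> /filter_ex[k kmu]; exists (ly k).2.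
have [/andP[l0 _] yk _ Sy] := lyP k; split=> [i|i]; first by case/andP: (yk i).
have /andP[yi0 yi1] := yk i.
apply: le_trans (_ : trop_apply (Sk k) (ly k).2 i <= _).
  apply: le_trop_apply => // [j|i']; first by rewrite ffunE lerDl ltW.
  by case/andP: (yk i') => /ltW.
rewrite Sy; apply: ler_pM => //; [exact: powR_ge0|exact: ltW|].
rewrite -powR_mulrn ?(ltW yi0)//; apply: ger_powR; first by rewrite yi0.
by rewrite lerDl ltW.
Qed.

(** * Comparison of values of [rho_trop]: scaling and geometric means *)

Lemma powR_prod (R : realType) (I : Type) (r : seq I) (f : I -> R) (t : R) :
  (forall i, 0 <= f i) ->
  \prod_(i <- r) f i `^ t = (\prod_(i <- r) f i) `^ t.
Proof.
move=> f0; elim: r => [|i r IHr]; first by rewrite !big_nil powR1.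
by rewrite !big_cons IHr powRM// prodr_ge0.
Qed.

Lemma le_mul_of_lt (R : realFieldType) (a b c : R) : 0 <= a -> 0 <= b ->
  (forall a' b', a < a' -> b < b' -> c <= a' * b') -> c <= a * b.
Proof.
move=> a0 b0 cab.
have ca a' : a < a' -> c <= a' * b.
  move=> aa'; have a'0 := le_lt_trans a0 aa'.
  rewrite -ler_pdivrMl//; apply/unstable.ler_gtP => b' bb'.
  by rewrite ler_pdivrMl// cab.
(* For b = 0 one cannot divide by b; the bound already obtained, at a' = a + 1, gives c <= 0. *)
move: b0; rewrite le_eqVlt => /predU1P[b0|b0].
  by rewrite -b0 mulr0 (le_trans (ca (a + 1) _)) ?ltrDl// -b0 mulr0.
rewrite -ler_pdivrMr//; apply/unstable.ler_gtP => a' aa'.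
by rewrite ler_pdivrMr// ca.
Qed.

Section RhoTrop.
Context {R : realType} {n d : nat}.
Context (n_gt0 : (0 < n)%N) (d_gt1 : (1 < d)%N).
Implicit Types S : tensor R n d.

Lemma rho_trop_supersolution S : (forall j, 0 <= S j) ->
  [/\ 0 <= rho_trop S,
      forall mu u, supersolution S mu u -> rho_trop S <= mu &
      forall mu, rho_trop S < mu -> exists u, supersolution S mu u].
Proof.
move=> S0; have [l Sl lS] := exists_eigenvalue_supersolution R n d S n_gt0 d_gt1 S0.
have -> : rho_trop S = l.
  apply: rho_tropE => // nu Snu; apply/unstable.ler_gtP => mu /lS[u].
  exact: eigenvalue_le_supersolution.
split=> // [|mu u]; last exact: eigenvalue_le_supersolution.
have [v [v0 vge0 Sv]] := Sl.
have /rV0Pn[i vi0] := v0.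
have vp : 0 < v ord0 i ^+ d.-1 by rewrite exprn_gt0// lt_neqAle eq_sym vi0 vge0.
by rewrite -(pmulr_lge0 _ vp) -Sv trop_apply_ge0.
Qed.

(** A supersolution of [S'] at level mu is one of [S] at level c mu. *)
Lemma rho_trop_le_scale S S' (c : R) : (forall j, 0 <= S j) -> 0 < c ->
  (forall j, S j <= c * S' j) -> rho_trop S <= c * rho_trop S'.
Proof.
move=> S0 c0 SS'.
have S'0 j : 0 <= S' j by rewrite -(pmulr_rge0 _ c0) (le_trans (S0 j)).
have [_ rle _] := rho_trop_supersolution S S0.
have [_ _ rlt] := rho_trop_supersolution S' S'0.
rewrite -ler_pdivrMl//; apply/unstable.ler_gtP => mu /rlt[u [u0 Su]].
rewrite ler_pdivrMl//; apply: (rle _ u); split=> // i.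
rewrite -mulrA; apply: bigmax_le => [|j ji].
  by rewrite mulr_ge0 ?(ltW c0)// (le_trans _ (Su i)) ?trop_apply_ge0.
apply: le_trans (_ : c * (S' j * \prod_(k <- behead j) u ord0 k) <= _).
  by rewrite mulrA ler_wpM2r// prodr_ge0// => k _; rewrite ltW.
by rewrite ler_pM2l// (le_trans (le_trop_apply_term S' u i j ji)).
Qed.

(** If u and w are supersolutions of [S1] and [S2] at levels mu and nu, then u^t w^(1-t) is one of
    [S] at level mu^t nu^(1-t), since geometric means commute with products. Letting the levels
    decrease gives the bound. *)
Lemma rho_trop_geometric_mean S S1 S2 (t : R) : 0 < t < 1 ->
  (forall j, 0 <= S j) -> (forall j, 0 <= S1 j) -> (forall j, 0 <= S2 j) ->
  (forall j, S j <= S1 j `^ t * S2 j `^ (1 - t)) ->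
  rho_trop S <= rho_trop S1 `^ t * rho_trop S2 `^ (1 - t).
Proof.
move=> /andP[t0 t1] S0 S10 S20 SS.
have t'0 : 0 < 1 - t by rewrite subr_gt0.
have [_ rle _] := rho_trop_supersolution S S0.
(* Every number above rho^s is mu^s for some supersolution level mu, so products of numbers above
   the two factors become products of powers of levels. *)
have ltroot S' (a s : R) : (forall j, 0 <= S' j) -> 0 < s -> rho_trop S' `^ s < a ->
    exists mu u, [/\ supersolution S' mu u, 0 <= mu & mu `^ s = a].
  move=> S'0 s0 ra; have [r0 _ rlt] := rho_trop_supersolution S' S'0.
  have a0 : 0 <= a by rewrite (le_trans (powR_ge0 _ _) (ltW ra)).
  have aE : (a `^ s^-1) `^ s = a by rewrite -powRrM mulVf ?gt_eqF// powRr1.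
  have [|u Su] := rlt (a `^ s^-1); last first.
    by exists (a `^ s^-1), u; split=> //; exact: powR_ge0.
  rewrite ltNge; apply/negP => ar; move: ra; rewrite ltNge -{1}aE => /negP; apply.
  by apply: ge0_ler_powR; rewrite ?nnegrE ?powR_ge0 ?(ltW s0).
apply: le_mul_of_lt; [exact: powR_ge0|exact: powR_ge0|].
move=> a b /ltroot[//|//|mu [u [[u0 Su] mu0 <-]]].
move=> /ltroot[//|//|nu [w [[w0 Sw] nu0 <-]]].
pose v : 'rV[R]_n := \row_i (u ord0 i `^ t * w ord0 i `^ (1 - t)).
apply: (rle _ v); split=> [i|i]; first by rewrite mxE mulr_gt0 ?powR_gt0.
have powX (x s : R) : 0 <= x -> (x ^+ d.-1) `^ s = (x `^ s) ^+ d.-1.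
  by move=> x0; rewrite -!powR_mulrn ?powR_ge0// powRAC.
have uge k : 0 <= u ord0 k by rewrite ltW.
have wge k : 0 <= w ord0 k by rewrite ltW.
rewrite mxE exprMn -!powX// mulrACA -!powRM ?exprn_ge0//.
apply: bigmax_le => [|j ji]; first by rewrite mulr_ge0 ?powR_ge0.
have Pu : 0 <= \prod_(k <- behead j) u ord0 k by exact: prodr_ge0.
have Pw : 0 <= \prod_(k <- behead j) w ord0 k by exact: prodr_ge0.
under eq_bigr do rewrite mxE.
rewrite big_split/= !powR_prod//.
apply: (@le_trans _ _ ((S1 j * \prod_(k <- behead j) u ord0 k) `^ t *
                       (S2 j * \prod_(k <- behead j) w ord0 k) `^ (1 - t))).
  by rewrite !powRM// mulrACA ler_wpM2r// mulr_ge0 ?powR_ge0.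
apply: ler_pM; rewrite ?powR_ge0//; apply: ge0_ler_powR;
  rewrite ?nnegrE ?mulr_ge0 ?exprn_ge0 ?(ltW t0) ?(ltW t'0)//.
  exact: le_trans (le_trop_apply_term S1 u i j ji) _.
exact: le_trans (le_trop_apply_term S2 w i j ji) _.
Qed.

End RhoTrop.

(** * Log-convexity through powers, and continuity through ratio bounds *)

Lemma lne_geometric_mean (R : realType) (a b c t : R) : 0 < t < 1 ->
  0 <= a -> 0 <= b -> 0 <= c ->
  (lne c%:E <= t%:E * lne a%:E + (1 - t)%:E * lne b%:E)%E =
  (c <= a `^ t * b `^ (1 - t)).
Proof.
move=> /andP[t0 t1] a0 b0 c0; have t'0 : 0 < 1 - t by rewrite subr_gt0.
have lne0 : lne (0 : R)%:E = -oo%E by rewrite le0_lneNy.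
have lnecN : (lne c%:E <= -oo)%E = (c <= 0).
  by rewrite /=; case: ifPn => // _; rewrite lexx.
move: a0; rewrite le_eqVlt => /predU1P[<-|a0].
  by rewrite lne0 gt0_muleNy// addNye powR0 ?gt_eqF// mul0r.
move: b0; rewrite le_eqVlt => /predU1P[<-|b0].
  by rewrite lne0 gt0_muleNy// addeNy powR0 ?(gt_eqF t'0)// mulr0.
have -> : (t%:E * lne a%:E + (1 - t)%:E * lne b%:E)%E
    = lne (a `^ t * b `^ (1 - t))%:E.
  rewrite !lne_EFin ?mulr_gt0 ?powR_gt0// lnM ?posrE ?powR_gt0//.
  by rewrite !ln_powR.
by rewrite lee_lne ?in_itv/= ?leey ?lee_fin ?c0 ?mulr_ge0 ?powR_ge0.
Qed.

Section Logconvex.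
Context {R : realType} {m : nat}.
Context (D : set 'rV[R]_m) (D_convex : convex_set D).
Implicit Types f : 'rV[R]_m -> R.
Local Open Scope convex_scope.

Lemma logconvex_cvg f x : logconvex D f -> D x ->
  lne (f z)%:E @[z --> within D (nbhs x)] --> lne (f x)%:E.
Proof. by move=> [_ /subspace_continuousP fc _]; exact: fc. Qed.

(** If f x = 0 and f y > 0, convexity forces the logarithm to be -oo at s x + (1-s) y for all s in
    (0, 1). These points tend to y as s decreases to 0, against continuity at y. *)
Lemma logconvex_eq0 f x y : logconvex D f -> D x -> D y -> f x = 0 -> f y = 0.
Proof.
move=> fD Dx Dy fx0; have [f0 _ fconv] := fD; apply/eqP; rewrite eq_le f0// andbT leNgt.
apply/negP => fy.
have fcy := logconvex_cvg _ _ fD Dy.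
have : \forall z \near within D (nbhs y), (-oo < lne (f z)%:E)%E.
  apply: (fcy [set e | (-oo < e)%E]).
  apply: open_nbhs_nbhs; split; first exact: open_ereal_gt_ereal.
  by rewrite /mkset lne_EFin// ltNyr.
rewrite near_withinE => near_y.
have zc : s *: x + (1 - s) *: y @[s --> (0 : R)] --> y.
  have -> : nbhs y = nbhs ((0 : R) *: x + (1 - 0) *: y).
    by rewrite scale0r add0r subr0 scale1r.
  apply: cvgD; first by apply: cvgZr_tmp; exact: cvg_id.
  apply: cvgZr_tmp; apply: cvgB; [exact: cvg_cst|exact: cvg_id].
have near0 : \forall s \near (0 : R)^'+,
    D (s *: x + (1 - s) *: y) -> (-oo < lne (f (s *: x + (1 - s) *: y))%:E)%E.
  by have zc0 := cvg_at_right_filter zc; exact: (zc0 _ near_y).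
suff : \forall s \near (0 : R)^'+, False by move=> /filter_ex[].
near=> s.
have s0 : 0 < s by [].
have s1 : s < 1 by near: s; exact: nbhs_right_lt.
pose t : {i01 R} := Itv01 (ltW s0) (ltW s1).
have Dz : D (s *: x + (1 - s) *: y).
  by have := D_convex x y t; rewrite !inE => /(_ Dx Dy).
have : (-oo < lne (f (s *: x + (1 - s) *: y))%:E)%E by move: Dz; near: s.
rewrite ltNge => /negP; apply.
apply: le_trans (fconv x y t Dx Dy) _.
rewrite fx0 [lne 0%:E]le0_lneNy// gt0_muleNy ?lte_fin// lne_EFin//.
Unshelve. all: by end_near. Qed.

Lemma logconvex_ratio f x0 (c : R) : logconvex D f -> D x0 -> 1 < c ->
  \forall x \near within D (nbhs x0), f x <= c * f x0 /\ f x0 <= c * f x.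
Proof.
move=> fD Dx0 c1; have [f0 _ _] := fD; have fc := logconvex_cvg _ _ fD Dx0.
have c0 : 0 < c by exact: lt_trans c1.
have := f0 _ Dx0; rewrite le_eqVlt => /predU1P[fx0|fx0].
  rewrite near_withinE; apply: filterE => x Dx.
  by rewrite -fx0 (logconvex_eq0 _ _ _ fD Dx0 Dx) ?mulr0.
have lc0 : 0 < ln c by rewrite ln_gt0.
have L : \forall x \near within D (nbhs x0), (lne (f x0 / c)%:E < lne (f x)%:E)%E.
  apply: (fc [set e | (lne (f x0 / c)%:E < e)%E]).
  apply: open_nbhs_nbhs; split; first exact: open_ereal_gt_ereal.
  rewrite /mkset lte_lne ?in_itv/= ?leey ?lee_fin ?divr_ge0 ?(ltW c0) ?(ltW fx0)//.
  by rewrite lte_fin ltr_pdivrMr// ltr_pMr.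
have U : \forall x \near within D (nbhs x0), (lne (f x)%:E < lne (c * f x0)%:E)%E.
  apply: (fc [set e | (e < lne (c * f x0)%:E)%E]).
  apply: open_nbhs_nbhs; split; first exact: open_ereal_lt_ereal.
  rewrite /mkset lte_lne ?in_itv/= ?leey ?lee_fin ?mulr_ge0 ?(ltW c0) ?(ltW fx0)//.
  by rewrite lte_fin ltr_pMl.
have Dn : \forall x \near within D (nbhs x0), D x by exact: withinT.
near=> x.
have Dx : D x by near: x.
have : (lne (f x0 / c)%:E < lne (f x)%:E)%E by near: x.
have : (lne (f x)%:E < lne (c * f x0)%:E)%E by near: x.
rewrite !lte_lne ?in_itv/= ?leey ?lee_fin ?divr_ge0 ?mulr_ge0 ?f0 ?(ltW c0) ?(ltW fx0)//.
rewrite !lte_fin => /ltW ? /ltW; rewrite ler_pdivrMr// mulrC => ?.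
by split.
Unshelve. all: by end_near. Qed.

(** At a zero of [f] the bounds force [f] to vanish nearby on [D], so the logarithm is locally
    constant. Elsewhere it is finite nearby, and the factor c = exp e becomes the additive error
    e. *)
Lemma lne_continuous_ratio f : (forall x, D x -> 0 <= f x) ->
  (forall x0 (c : R), D x0 -> 1 < c ->
    \forall x \near within D (nbhs x0), f x <= c * f x0 /\ f x0 <= c * f x) ->
  {within D, continuous (fun x => lne (f x)%:E)}.
Proof.
move=> f0 fr; apply/subspace_continuousP => x0 Dx0.
suff : lne (f z)%:E @[z --> within D (nbhs x0)] --> lne (f x0)%:E by [].
have Dn : \forall x \near within D (nbhs x0), D x by exact: withinT.
have := f0 _ Dx0; rewrite le_eqVlt => /predU1P[fx0|fx0].
  apply: cvg_near_cst.
  have F2 : \forall x \near within D (nbhs x0), f x <= 2 * f x0 /\ f x0 <= 2 * f x.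
    by apply: fr => //; rewrite ltr1n.
  near=> x.
  have Dx : D x by near: x.
  have [+ _] : f x <= 2 * f x0 /\ f x0 <= 2 * f x by near: x.
  rewrite -fx0 mulr0 => fx; have -> : f x = 0; last by [].
  by apply/eqP; rewrite eq_le fx f0.
rewrite lne_EFin//; apply: cvg_EFin.
  have F2 : \forall x \near within D (nbhs x0), f x <= 2 * f x0 /\ f x0 <= 2 * f x.
    by apply: fr => //; rewrite ltr1n.
  near=> x.
  have [_ h] : f x <= 2 * f x0 /\ f x0 <= 2 * f x by near: x.
  by rewrite lne_EFin// -(pmulr_rgt0 _ (ltr0n R 2)) (lt_le_trans fx0).
apply/cvgrPdist_le => e e0.
have c1 : 1 < expR e by rewrite expR_gt1.
have Fe := fr x0 (expR e) Dx0 c1.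
near=> x.
have [h1 h2] : f x <= expR e * f x0 /\ f x0 <= expR e * f x by near: x.
have fx : 0 < f x by rewrite -(pmulr_rgt0 _ (expR_gt0 e)) (lt_le_trans fx0).
have -> : (fine \o (fun x => lne (f x)%:E)) x = ln (f x) by rewrite compE lne_EFin.
rewrite ler_norml; apply/andP; split.
  rewrite lerBrDl lerBlDr -[X in _ <= _ + X]expRK addrC -lnM ?posrE ?expR_gt0//.
  by rewrite ler_ln ?posrE ?mulr_gt0 ?expR_gt0.
rewrite lerBlDr -[X in _ <= X + _]expRK -lnM ?posrE ?expR_gt0//.
by rewrite ler_ln ?posrE ?mulr_gt0 ?expR_gt0.
Unshelve. all: by end_near. Qed.

End Logconvex.

Theorem corollary29 (R : realType) (m n d : nat)
  (hm : (1 <= m)%N) (hn : (1 <= n)%N) (hd : (3 <= d)%N)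
  (D : set 'rV[R]_m) (hD : convex_set D)
  (T : 'rV[R]_m -> tensor R n d) (hT : logconvex_tensor D T) :
  logconvex D (fun x => rho_trop (T x)).
Proof.
have d1 : (1 < d)%N by exact: ltnW.
have T0 x j : D x -> 0 <= T x j by move=> Dx; have [+ _ _] := hT j; apply.
have r0 x : D x -> 0 <= rho_trop (T x).
  by move=> Dx; have [] := rho_trop_supersolution hn d1 (T x) (fun j => T0 x j Dx).
split=> // [|x y t Dx Dy].
  apply: lne_continuous_ratio => // x0 c Dx0 c1.
  have c0 : 0 < c by exact: lt_trans c1.
  have Dn : \forall x \near within D (nbhs x0), D x by exact: withinT.
  have Tn : \forall x \near within D (nbhs x0), forall j : d.-tuple 'I_n,
      T x j <= c * T x0 j /\ T x0 j <= c * T x j.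
    (* There are finitely many multi-indices, so the neighbourhoods of the separate entries
       intersect in one. *)
    apply: filter_forall => j; exact: (logconvex_ratio D hD (fun x => T x j)).
  near=> x.
  have Dx : D x by near: x.
  have Tx : forall j : d.-tuple 'I_n,
      T x j <= c * T x0 j /\ T x0 j <= c * T x j by near: x.
  split; apply: rho_trop_le_scale => // j; by [exact: T0|case: (Tx j)].
(* At t = 0 and t = 1 the convex combination is an endpoint and equality holds; the power form below
   requires 0 < t < 1. *)
have [->|t0] := eqVneq t 0%:i01.
  by rewrite conv0/= mul0e add0e subr0 mul1e.
have [->|t1] := eqVneq t 1%:i01.
  by rewrite conv1/= subrr mul0e adde0 mul1e.
have Dz : D (conv t x y).
  by have := hD x y t; rewrite !inE => /(_ Dx Dy).
have t01 : 0 < t%:num < 1.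
  by rewrite !lt_neqAle eq_sym t0 ge0 le1 t1.
rewrite lne_geometric_mean ?r0//.
apply: rho_trop_geometric_mean => // j; try exact: T0.
by rewrite -lne_geometric_mean ?T0//; have [_ _] := hT j; apply.
Unshelve. all: by end_near. Qed.
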